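(* Let $\sigma$ be a partition of a positive integer $r$ with largest part $\Delta \geq 2$, let $n,q$ be positive integers, and let $H=H(n,r,q\mid\sigma)$. Let $\alpha,\beta$ be integers with $2 \leq \alpha \leq s(\sigma) = \beta$, and suppose $n \geq s(\sigma)^2$ and $q \geq (\Delta-1)\beta +1$. Then in every $(\alpha,\beta)$-colouring of $H$ every class of $H$ is monochromatic; consequently the $(\alpha,\beta)$-spectrum of $H$ equals the $(\alpha,\beta)$-monochromatic zone of $H$.
   Context: For a partition $\sigma$ of $r$ and positive integers $n,q$, the $\sigma$-hypergraph $H(n,r,q\mid\sigma)$ is the $r$-uniform hypergraph whose vertex set has $nq$ vertices partitioned into $n$ classes $V_1,\dots,V_n$ of $q$ vertices each, and in which an $r$-subset $K$ of the vertex set is an edge if and only if the multiset of non-zero cardinalities $|K\cap V_i|$, $1\le i\le n$, is exactly the partition $\sigma$. $s(\sigma)$ denotes the number of parts of $\sigma$ and $\Delta$ its largest part. For integers $\alpha\le\beta$, an $(\alpha,\beta)$-colouring of a hypergraph is an assignment of colours to its vertices such that every edge contains at least $\alpha$ and at most $\beta$ distinct colours; a $k$-$(\alpha,\beta)$-colouring is one using exactly $k$ colours. The $(\alpha,\beta)$-spectrum is the set of all $k$ for which a $k$-$(\alpha,\beta)$-colouring exists. The $(\alpha,\beta)$-monochromatic zone of a $\sigma$-hypergraph is the set of all integers $k$ for which there exists a $k$-$(\alpha,\beta)$-colouring in which every class $V_i$ is monochromatic. *)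

(* Defs.v *)
From mathcomp Require Import all_boot.

Set Implicit Arguments.
Unset Strict Implicit.
Unset Printing Implicit Defensive.

(* Integer partitions are represented by their weakly decreasing list of      *)
(* (positive) parts.                                                          *)
Definition is_partition_of (r : nat) (sigma : seq nat) : bool :=
  [&& sorted geq sigma, 0 \notin sigma & sumn sigma == r].

Definition largest_part (sigma : seq nat) : nat := \max_(p <- sigma) p.

(* A hypergraph on a finite type V is given by its set of edges. Colours are  *)
(* taken in an arbitrary eqType C, hence the count through undup.             *)
Section Colourings.

Variables (V : finType) (E : {set {set V}}) (alpha beta : nat).

Definition ncolours (C : eqType) (c : V -> C) (A : {set V}) : nat :=
  size (undup [seq c v | v in A]).

Definition is_colouring (C : eqType) (c : V -> C) : Prop :=
  forall K : {set V}, K \in E -> alpha <= ncolours c K <= beta.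

Definition is_k_colouring (k : nat) (C : eqType) (c : V -> C) : Prop :=
  is_colouring c /\ ncolours c [set: V] = k.

Definition monochromatic (C : eqType) (c : V -> C) (A : {set V}) : Prop :=
  {in A &, forall u v : V, c u = c v}.

(* As V is finite, colours in nat give the same k as colours in any eqType.   *)
Definition in_spectrum (k : nat) : Prop :=
  exists c : V -> nat, is_k_colouring k c.

End Colourings.

Section SigmaHypergraph.

Variables n q : nat.

Definition vclass (i : 'I_n) : {set 'I_n * 'I_q} := [set v | v.1 == i].

Definition class_sizes (K : {set 'I_n * 'I_q}) : seq nat :=
  [seq m <- [seq #|K :&: vclass i| | i : 'I_n] | m != 0].

Definition sigma_hypergraph (r : nat) (sigma : seq nat) :
    {set {set 'I_n * 'I_q}} :=
  [set K : {set 'I_n * 'I_q} |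
     (#|K| == r) && perm_eq (class_sizes K) sigma].

Definition classes_monochromatic (C : eqType) (c : 'I_n * 'I_q -> C) : Prop :=
  forall i : 'I_n, monochromatic c (vclass i).

Definition in_monochromatic_zone (r : nat) (sigma : seq nat)
    (alpha beta k : nat) : Prop :=
  exists c : 'I_n * 'I_q -> nat,
    is_k_colouring (sigma_hypergraph r sigma) alpha beta k c /\
    classes_monochromatic c.

End SigmaHypergraph.

Arguments sigma_hypergraph : clear implicits.
Arguments in_monochromatic_zone : clear implicits.

(* Main.v *)
Require Import Defs.
From mathcomp Require Import all_boot.

(** Suppose a class contains vertices [v0], [v1] of different colours, and put
    [s = s(sigma)].  Try to pick greedily [s - 1] further vertices in distinct
    other classes, each of a new colour.  If this succeeds, an edge with
    [Delta] vertices in the class of [v0], among them [v0] and [v1], and through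
    the picked vertices has more than [s = beta] colours.  If it gets stuck, at
    least [s (s - 1) + 1] classes use at most [s] colours; as
    [q > (Delta - 1) s], each of them has a colour occurring at least [Delta]
    times, and [s] of them share this colour, which gives a monochromatic edge,
    against [alpha >= 2]. *)

(** * Counting tools for finite sets *)

(** Induction on the list [s] of values: either its head is taken more than [m] times, or discarding
    the elements with that value costs at most [m] of them. Used for vertices in a class and then
    for classes. *)
Lemma pigeonhole (T : finType) (C : eqType) (f : T -> C) (A : {set T})
    (s : seq C) (m : nat) :
  {in A, forall x, f x \in s} -> m * size s < #|A| ->
  exists2 a, a \in s & m < #|[set x in A | f x == a]|.
Proof.
elim: s A => [|b s IHs] A fA.
  by rewrite muln0 card_gt0 => /set0Pn[x /fA].
rewrite mulnS => ltA; case: (ltnP m #|[set x in A | f x == b]|) => [ltb|leb].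
  by exists b; rewrite ?mem_head.
have [||a as_ lta] := IHs [set x in A | f x != b].
- move=> x; rewrite inE => /andP[/fA]; rewrite inE.
  by case/orP=> [->|].
- have: #|A| = #|[set x in A | f x == b]| + #|[set x in A | f x != b]|.
    rewrite -(cardsID [set x | f x == b] A).
    by congr (_ + _); apply: eq_card => x; rewrite !inE // andbC.
  by move=> eqA; rewrite -(ltn_add2l m) (leq_trans ltA) // eqA leq_add2r.
exists a; first by rewrite inE as_ orbT.
apply: leq_trans lta _; apply/subset_leq_card/subsetP=> x.
by rewrite !inE => /andP[/andP[-> _]].
Qed.

Lemma uniq_map_inj (T1 T2 : eqType) (f : T1 -> T2) (s : seq T1) :
  uniq [seq f x | x <- s] -> {in s &, injective f}.
Proof.
elim: s => //= a s IHs /andP[nfa /IHs inj_f] x y.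
rewrite !inE => /predU1P[->|xs] /predU1P[->|ys] // eqf; last exact: inj_f.
  by rewrite eqf map_f in nfa.
by rewrite -eqf map_f in nfa.
Qed.

Lemma subset_of_card_between (T : finType) (A B : {set T}) (k : nat) :
  A \subset B -> #|A| <= k <= #|B| ->
  exists D : {set T}, [/\ A \subset D, D \subset B & #|D| = k].
Proof.
move=> sAB /andP[leAk lekB].
have sizeBA : k - #|A| <= size (enum (B :\: A)).
  by rewrite -cardE cardsD (setIidPr sAB) leq_sub2r.
pose E := [set x in take (k - #|A|) (enum (B :\: A))].
have sE : E \subset B :\: A.
  by apply/subsetP=> x; rewrite inE => /mem_take; rewrite mem_enum.
exists (A :|: E); split; first exact: subsetUl.
  by rewrite subUset sAB (subset_trans sE) ?subsetDl.
rewrite cardsU (_ : A :&: E = set0) ?cards0 ?subn0; last first.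
  apply/setP=> x; rewrite !inE; apply/andP=> -[xA xE].
  by have:= subsetP sE x; rewrite !inE xA /=; move/(_ xE).
rewrite cardsE (card_uniqP _) ?take_uniq ?enum_uniq // size_takel //.
by rewrite subnKC.
Qed.

(** * Edges with prescribed traces on the classes *)

Section Edges.

Variables (n q : nat).
Implicit Types (F : 'I_n -> {set 'I_q}) (K : {set 'I_n * 'I_q}).

Definition fibred_set F : {set 'I_n * 'I_q} := [set v | v.2 \in F v.1].

Lemma card_fibred_set_class F (i : 'I_n) :
  #|fibred_set F :&: vclass q i| = #|F i|.
Proof.
have inj_i : injective (pair i : 'I_q -> _) by move=> x y [].
rewrite -(card_imset (mem (F i)) inj_i).
apply: eq_card => -[j x]; rewrite !inE /=.
apply/andP/imsetP=> [[xF /eqP ji]|[y yF [-> ->]]] //.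
by exists x; rewrite -ji.
Qed.

(** The classes partition the vertices and empty traces add 0; so the class sizes of an edge
    determine its cardinality. *)
Lemma card_sum_class_sizes K : #|K| = sumn (class_sizes K).
Proof.
have ->: sumn (class_sizes K) = \sum_(i : 'I_n) #|K :&: vclass q i|.
  rewrite /class_sizes sumnE big_filter big_mkcond big_image /=.
  by apply: eq_bigr => i _; case: eqP.
rewrite -sum1_card (partition_big (fun v => v.1) predT) //=.
apply: eq_bigr => i _; rewrite -sum1_card.
by apply: eq_bigl => v; rewrite !inE.
Qed.

(** The j-th class of [idx] receives the j-th part of [sigma]: its trace is chosen of that size
    between the forced vertices [B] and the allowed vertices [T]. Both kinds of edge used below
    arise this way. *)
Lemma edge_between (r : nat) (sigma : seq nat) (idx : seq 'I_n)
    (B T : 'I_n -> {set 'I_q}) :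
  is_partition_of r sigma -> uniq idx -> size idx = size sigma ->
  {in idx, forall i, B i \subset T i /\
     #|B i| <= nth 0 sigma (index i idx) <= #|T i|} ->
  exists K, [/\ K \in sigma_hypergraph n q r sigma,
    {in K, forall v, v.1 \in idx /\ v.2 \in T v.1} &
    forall i x, i \in idx -> x \in B i -> (i, x) \in K].
Proof.
case/and3P=> _ sigma0 /eqP sumr uniq_idx size_idx BT.
have /fin_all_exists[F FP] : forall i, exists D : {set 'I_q},
    [/\ #|D| = nth 0 sigma (index i idx), i \in idx -> B i \subset D,
        i \in idx -> D \subset T i & i \notin idx -> D = set0].
  move=> i; case: (boolP (i \in idx)) => [/BT[sBT le]|idx'i].
    by have [D [? ? ?]] := subset_of_card_between _ _ _ _ sBT le; exists D.
  exists set0; split=> //.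
  (* Outside [idx] the index equals [size sigma], so [nth] returns its default 0, the size of the
     empty trace. *)
  by rewrite cards0 nth_default // memNindex // size_idx.
have sizesF : perm_eq (class_sizes (fibred_set F)) sigma.
  rewrite /class_sizes /image_mem (eq_map (card_fibred_set_class F)).
  (* With the classes of [idx] listed first, the trace sizes read [sigma] followed by zeros, which
     the filter drops. *)
  have perm_enum :
      perm_eq (enum 'I_n) (idx ++ [seq i <- enum 'I_n | i \notin idx]).
    rewrite -(perm_filterC (mem idx)) perm_cat2r; apply: uniq_perm => //.
      by rewrite filter_uniq ?enum_uniq.
    by move=> i; rewrite mem_filter mem_enum andbT.
  apply: perm_trans (perm_filter _ (perm_map _ perm_enum)) _.
  rewrite map_cat filter_cat.
  have ->: [seq #|F i| | i <- idx] = sigma.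
    apply: (@eq_from_nth _ 0); rewrite size_map // => j ltj.
    have i0 : 'I_n by case: (idx) ltj => // i0.
    rewrite (nth_map i0) //.
    by have [-> _ _ _] := FP (nth i0 idx j); rewrite index_uniq.
  rewrite (_ : [seq m <- sigma | m != 0] = sigma); last first.
    by apply/all_filterP/allP=> m ms; apply: contraNneq sigma0 => <-.
  rewrite (_ : [seq m <- map _ _ | _] = [::]) ?cats0 //.
  apply/eqP; rewrite -[_ == _]negbK -has_filter -all_predC all_map.
  apply/allP=> i; rewrite mem_filter => /andP[idx'i _] /=.
  by have [_ _ _ ->] := FP i; rewrite ?cards0.
exists (fibred_set F); split.
- by rewrite inE sizesF card_sum_class_sizes (perm_sumn sizesF) sumr eqxx.
- move=> v; rewrite inE => vF; have [_ _ sFT F0] := FP v.1.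
  case: (boolP (v.1 \in idx)) => [v1|/F0 eF]; last by rewrite eF inE in vF.
  by split=> //; apply: (subsetP (sFT v1)).
- by move=> i x ii xB; rewrite inE; have [_ /(_ ii)/subsetP-> //] := FP i.
Qed.

End Edges.

Lemma leq_nth_largest_part (sigma : seq nat) (j : nat) :
  nth 0 sigma j <= largest_part sigma.
Proof.
case: (ltnP j (size sigma)) => ltj; last by rewrite nth_default.
by rewrite /largest_part (@leq_bigmax_seq _ _ predT id) ?mem_nth.
Qed.

(** Ensures that the class placed first in [idx] has room for two forced vertices once the largest
    part is at least 2. *)
Lemma largest_part_head (r : nat) (sigma : seq nat) :
  is_partition_of r sigma -> largest_part sigma <= nth 0 sigma 0.
Proof.
case/and3P=> sorted_sigma _ _; apply/bigmax_leqP_seq=> p + _.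
case: sigma sorted_sigma => //= a sigma path_sigma.
rewrite inE => /predU1P[-> //|psigma].
have geq_trans : transitive geq by move=> y x z /= xy yz; apply: leq_trans yz xy.
exact: (allP (order_path_min geq_trans path_sigma)).
Qed.

(** * Edges with too few or too many colours *)

Section ColouredEdges.

Variables (n r q : nat) (sigma : seq nat) (C : eqType) (c : 'I_n * 'I_q -> C).
Hypothesis sigma_part : is_partition_of r sigma.

Lemma monochromatic_edge (D : {set 'I_n}) (s : seq C) :
  {in D, forall i x, c (i, x) \in s} -> size s <= size sigma ->
  size sigma * (size sigma - 1) < #|D| ->
  (largest_part sigma - 1) * size sigma < q ->
  exists2 K, K \in sigma_hypergraph n q r sigma & ncolours c K <= 1.
Proof.
move=> Ds size_s ltD ltq.
pose big_colour i a := largest_part sigma - 1 < #|[set x | c (i, x) == a]|.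
(* First pigeonhole, over the [q] vertices of a class of [D]: some colour occurs at least
   [largest_part sigma] times. *)
have has_big i : i \in D -> has (big_colour i) s.
  move=> Di; have [||a as_ lta] := pigeonhole _ _ (fun x => c (i, x)) setT s
      (largest_part sigma - 1).
  - by move=> x _; apply: Ds.
  - by rewrite cardsT card_ord (leq_ltn_trans _ ltq) // leq_mul2l size_s orbT.
  apply/hasP; exists a => //; apply: leq_trans lta _.
  by apply/subset_leq_card/subsetP=> x; rewrite !inE.
have [i0 Di0] : exists i, i \in D.
  by apply/set0Pn; rewrite -card_gt0 (leq_trans _ ltD).
have [a0 _ _] := hasP (has_big _ Di0).
(* [f i] is the first such colour of class [i]; [a0] only serves as a default. The second
   pigeonhole, over [D], finds [size sigma] classes sharing one. *)
pose f i := nth a0 s (find (big_colour i) s).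
have [||a as_ lta] := pigeonhole _ _ f D s (size sigma - 1).
- by move=> i Di; rewrite mem_nth // -has_find has_big.
- by rewrite (leq_ltn_trans _ ltD) // mulnC leq_mul2r size_s orbT.
set A := [set i in D | f i == a] in lta.
have size_idx : size (take (size sigma) (enum A)) = size sigma.
  by rewrite size_takel // -cardE (leq_trans _ lta) // subn1 leqSpred.
have idxA i : i \in take (size sigma) (enum A) -> big_colour i a.
  move/mem_take; rewrite mem_enum inE => /andP[Di /eqP <-].
  by apply: nth_find; apply: has_big.
(* No vertex is forced, and only those of colour [a] are allowed. *)
have [||||K [KE KT _]] := @edge_between n q r sigma (take (size sigma) (enum A))
    (fun=> set0) (fun i => [set x | c (i, x) == a]) => //.
- by rewrite take_uniq ?enum_uniq.
- move=> i /idxA big_i; rewrite sub0set cards0; split=> //=.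
  apply: leq_trans (leq_nth_largest_part _ _) (leq_trans _ big_i).
  by rewrite subn1 leqSpred.
exists K => //; rewrite /ncolours.
apply: (uniq_leq_size (s2 := [:: a]) (undup_uniq _)) => b.
rewrite mem_undup => /mapP[[i x]]; rewrite mem_enum => /KT[_ /=].
by rewrite !inE => /eqP-> ->.
Qed.

(** The [size sigma + 1] listed vertices occupy [size sigma] classes. That of [v0] and [v1] comes
    first, so it gets a largest part; each other class holds one listed vertex, and its part is
    positive. *)
Lemma rainbow_edge (v0 v1 : 'I_n * 'I_q) (ws : seq ('I_n * 'I_q)) :
  1 < largest_part sigma <= q -> v0.1 = v1.1 ->
  uniq [seq w.1 | w <- v0 :: ws] -> uniq [seq c w | w <- [:: v0, v1 & ws]] ->
  (size ws).+1 = size sigma ->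
  exists2 K, K \in sigma_hypergraph n q r sigma & size sigma < ncolours c K.
Proof.
move=> /andP[Delta_gt1 leq] v01 uniq_cl uniq_col size_ws.
pose B i := [set x | (i, x) \in [:: v0, v1 & ws]].
have [||K [KE _ KB]] := @edge_between n q r sigma [seq w.1 | w <- v0 :: ws]
    B (fun=> setT) sigma_part uniq_cl.
- by rewrite /= size_map.
- move=> i ii; rewrite subsetT cardsT card_ord; split=> //.
  apply/andP; split; last first.
    exact: leq_trans (leq_nth_largest_part _ _) leq.
  case: (eqVneq v0.1 i) ii => [<- _|v0i].
    rewrite /= eqxx /=.
    apply: leq_trans (leq_trans Delta_gt1 (largest_part_head _ _ sigma_part)).
    apply: leq_trans (subset_leq_card (_ : _ \subset [set v0.2; v1.2])) _.
      apply/subsetP=> x; rewrite !inE.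
      case/or3P=> [/eqP<-|/eqP<-|xws]; rewrite ?eqxx ?orbT //.
      by case/andP: uniq_cl => /negP[]; apply/mapP; exists (v0.1, x).
    by rewrite cards2; case: (_ != _).
  move=> ii; have {}ii : i \in [seq w.1 | w <- ws].
    by move: ii; rewrite inE eq_sym (negPf v0i).
  have part_gt0 : 0 < nth 0 sigma (index i [seq w.1 | w <- v0 :: ws]).
    case/and3P: sigma_part => _ sigma0 _; rewrite lt0n.
    apply: contraNneq sigma0 => <-; rewrite mem_nth // -size_ws.
    rewrite -[in X in _ < X](size_map (fun w => w.1) ws) /=.
    by rewrite (negPf v0i) ltnS index_mem.
  apply: leq_trans part_gt0; case/mapP: ii => w ww eq_i.
  apply: leq_trans (subset_leq_card (_ : _ \subset [set w.2])) _; last first.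
    by rewrite cards1.
  apply/subsetP=> x; rewrite !inE => /or3P[/eqP e|/eqP e|xws].
  + by rewrite -e eqxx in v0i.
  + by rewrite v01 -e eqxx in v0i.
  have /uniq_map_inj inj1 : uniq [seq w.1 | w <- ws] by case/andP: uniq_cl.
  by rewrite -(inj1 _ _ xws ww eq_i).
exists K => //; rewrite -size_ws.
rewrite -[(size ws).+2]/(size [:: v0, v1 & ws]) -(size_map c).
apply: uniq_leq_size => // b /mapP[[i x] wv ->]; rewrite mem_undup.
apply/mapP; exists (i, x) => //; rewrite mem_enum; apply: KB; last by rewrite inE.
move: wv; rewrite !inE => /or3P[/eqP e|/eqP e|wws] /=.
- by rewrite -e eqxx.
- by rewrite v01 -e eqxx.
by rewrite (map_f (fun w => w.1) wws) orbT.
Qed.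

End ColouredEdges.

(** * The greedy choice and the conclusion *)

Lemma colouring_classes_monochromatic (n r q : nat) (sigma : seq nat)
    (alpha : nat) (C : eqType) (c : 'I_n * 'I_q -> C) :
  is_partition_of r sigma -> 1 < largest_part sigma -> 1 < alpha ->
  size sigma ^ 2 <= n -> (largest_part sigma - 1) * size sigma < q ->
  is_colouring (sigma_hypergraph n q r sigma) alpha (size sigma) c ->
  classes_monochromatic c.
Proof.
move=> part Delta_gt1 alpha_gt1 le_n lt_q colc i v0 v1.
rewrite !inE => /eqP v0i /eqP v1i; apply/eqP/negPn/negP=> cv01.
have sigma_gt0 : 0 < size sigma.
  rewrite lt0n; apply: contraTneq Delta_gt1 => /size0nil->.
  by rewrite /largest_part big_nil.
have Delta_le : largest_part sigma <= q.
  apply: leq_trans lt_q.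
  rewrite -ltnS -[in X in X < _](subnK (ltnW Delta_gt1)) addn1 !ltnS.
  by rewrite leq_pmulr.
have greedy t : t < size sigma -> exists ws : seq ('I_n * 'I_q),
    [/\ size ws = t, uniq [seq w.1 | w <- v0 :: ws] &
        uniq [seq c w | w <- [:: v0, v1 & ws]]].
  elim: t => [_|t IHt ltt].
    by exists [::]; rewrite /= inE cv01.
  have [ws [size_ws uniq_cl uniq_col]] := IHt (ltnW ltt).
  pose D := [set i | i \notin [seq w.1 | w <- v0 :: ws]].
  (* Either some vertex extends [ws], or the unvisited classes [D] use only the
     [t + 2 <= size sigma] colours already seen. *)
  have [w|stuck] := pickP (fun w => (w.1 \in D) &&
      (c w \notin [seq c w | w <- [:: v0, v1 & ws]])).
    rewrite !inE /= !negb_or => /andP[/andP[wv0 wws] /and3P[cwv0 cwv1 cwws]].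
    exists (w :: ws); split; first by rewrite /= size_ws.
      by move: uniq_cl; rewrite /= !inE !negb_or eq_sym wv0 wws.
    move: uniq_col; rewrite /= !inE !negb_or cwws => /and3P[/andP[-> ->] -> ->].
    by rewrite eq_sym cwv0 eq_sym cwv1.
  have [||||K KE] := @monochromatic_edge n r q sigma C c part D
      [seq c w | w <- [:: v0, v1 & ws]].
  - move=> j Dj x; have:= stuck (j, x); rewrite Dj /=.
    by move/negbFE.
  - by rewrite size_map /= size_ws.
  (* Writing s for [size sigma], the bound [t + 1 < s] leaves at least s^2 - (s - 1) = s (s - 1) + 1
     classes in [D]. *)
  - have: #|D| + t.+1 = n.
      rewrite -[RHS]card_ord -(cardsC D); congr (_ + _).
      rewrite -size_ws -[(size ws).+1]/(size (v0 :: ws)).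
      rewrite -(size_map (fun w => w.1)) -(card_uniqP uniq_cl).
      by apply: eq_card => j; rewrite in_setC in_set negbK.
    move=> eqn; rewrite -(ltn_add2r t.+1) eqn; apply: leq_trans le_n.
    have ->: size sigma ^ 2 = size sigma * (size sigma - 1) + size sigma.
      by rewrite mulnBr muln1 subnK ?leq_pmulr // mulnn.
    by rewrite -addnS leq_add2l.
  - by [].
  by case/andP: (colc K KE) => leK _ /(leq_trans (leq_trans alpha_gt1 leK)).
have [|ws [size_ws uniq_cl uniq_col]] := greedy (size sigma).-1.
  by rewrite ltn_predL.
have [|||K KE] := @rainbow_edge n r q sigma C c part v0 v1 ws _ _
    uniq_cl uniq_col.
- by rewrite Delta_gt1.
- by rewrite v0i.
- by rewrite size_ws prednK.
by case/andP: (colc K KE) => _ leK; rewrite ltnNge leK.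
Qed.

Theorem theorem3p3 (n r q : nat) (sigma : seq nat) (alpha beta : nat)
    (r_gt0 : 0 < r) (n_gt0 : 0 < n) (q_gt0 : 0 < q)
    (sigma_part : is_partition_of r sigma)
    (Delta_ge2 : 2 <= largest_part sigma)
    (alpha_ge2 : 2 <= alpha) (alpha_le : alpha <= size sigma)
    (beta_eq : size sigma = beta)
    (n_ge : size sigma ^ 2 <= n)
    (q_ge : (largest_part sigma - 1) * beta + 1 <= q) :
  (forall (C : eqType) (c : 'I_n * 'I_q -> C),
     is_colouring (sigma_hypergraph n q r sigma) alpha beta c ->
     classes_monochromatic c) /\
  (forall k : nat,
     in_spectrum (sigma_hypergraph n q r sigma) alpha beta k <->
     in_monochromatic_zone n q r sigma alpha beta k).
Proof.
move: q_ge; rewrite -beta_eq addn1 => q_gt.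
have mono := colouring_classes_monochromatic n r q sigma alpha _ _
  sigma_part Delta_ge2 alpha_ge2 n_ge q_gt.
split=> [C c|k]; first exact: mono.
(* The same colouring serves in both directions; the first part makes its classes monochromatic. *)
split=> [[c kc]|[c [kc _]]]; exists c => //.
by split=> //; apply: (mono _ _ kc.1).
Qed.
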